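(* Let $m\ge 1$ be an integer, let $c_1,\dots,c_m$ be real numbers with $c_m\neq 0$, and let $\{a_k\}_{k\ge 1}$ be the sequence of real numbers defined by $$a_k=c_1a_{k-1}+c_2a_{k-2}+\cdots+c_ma_{k-m}\qquad(k\ge m+1)$$ with given real initial values $a_1,\dots,a_m$. Let $n>m$ be an integer and let $A=\mathrm{circ}(a_1,a_2,\dots,a_n)$. If $m\ge 2$, assume $a_1\ne a_{n+1}$. Then $$\det(A)=(a_1-a_{n+1})^{n-m}\sum_{k_1=2}^{n}\cdots\sum_{k_{m-1}=2}^{n}\left|\begin{array}{cccc} a_1 & a_{(k_1)} & \cdots & a_{(k_{m-1})}\\ a_2 & a_{(k_1+1)} & \cdots & a_{(k_{m-1}+1)}\\ \vdots & \vdots & & \vdots\\ a_m & a_{(k_1+m-1)} & \cdots & a_{(k_{m-1}+m-1)}\end{array}\right|\prod_{i=1}^{m-1} b^{(i)}_{n-k_i+1},$$ where the bracketed-index notation $a_{(\cdot)}$ and the sequences $\{b_s^{(r)}\}$ ($1\le r\le m-1$) are as defined in the context. (For $m=1$ there are no summations, the determinant is the $1\times 1$ determinant $a_1$, and the product is empty.)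
   Context: The circulant matrix $\mathrm{circ}(v_1,\dots,v_n)$ is the $n\times n$ matrix with first row $(v_1,v_2,\dots,v_n)$ in which each subsequent row is the cyclic shift by one place to the right of the preceding row; that is, its $(i,j)$ entry is $v_{j-i+1}$ if $j\ge i$ and $v_{n+j-i+1}$ if $j<i$. Bracketed indices: for an integer $s$, $a_{(s)}$ denotes $a_r$, where $r\in\{1,\dots,n\}$ is the unique integer with $r\equiv s \pmod n$. Thus the $(i,j)$ entry of $A$ is $A_{ij}=a_{(j-i+1)}$. For $1\le t\le m$ define $$\alpha_t=A_{n-m+1,\,n-m+t}-c_1A_{n-m+2,\,n-m+t}-\cdots-c_{m-1}A_{n,\,n-m+t}-c_mA_{1,\,n-m+t}.$$ In particular $\alpha_1=a_1-a_{n+1}$. For each $r=1,\dots,m-1$ the sequence $\{b_s^{(r)}\}_{s\ge1}$ is defined by the initial conditions $b_i^{(r)}=\delta_{i,r}$ (Kronecker delta) for $i=1,\dots,m-1$, and the recurrence $$b_s^{(r)}=-\frac{\alpha_2}{\alpha_1}b_{s-1}^{(r)}-\frac{\alpha_3}{\alpha_1}b_{s-2}^{(r)}-\cdots-\frac{\alpha_m}{\alpha_1}b_{s-m+1}^{(r)}\qquad(s\ge m).$$ *)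

(* Defs.v *)
From HB Require Import structures.
From mathcomp Require Import all_boot all_order all_algebra.
From mathcomp Require Import reals.

Set Implicit Arguments.
Unset Strict Implicit.
Unset Printing Implicit Defensive.

Import Order.TTheory GRing.Theory Num.Theory.
Local Open Scope ring_scope.

(* Sequences are functions nat -> R used from index 1 on; the value at 0 is
   irrelevant. Row, column and sequence indices below are 1-based, except for
   the ordinals indexing MathComp matrices, which are shifted by .+1. *)

Section Circulant.
Variable R : realType.
Implicit Types a c v b : nat -> R.

Definition linrec (m : nat) c a : Prop :=
  forall k, (m < k)%N -> a k = \sum_(1 <= j < m.+1) c j * a (k - j)%N.

Definition circ_entry (n : nat) v (i j : nat) : R :=
  if (i <= j)%N then v (j - i + 1)%N else v (n + j - i + 1)%N.

Definition circ (n : nat) v : 'M[R]_n :=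
  \matrix_(i < n, j < n) circ_entry n v i.+1 j.+1.

(* For 0 < n, the unique r in {1, ..., n} with r = s modulo n. *)
Definition bridx (n : nat) (s : int) : nat := `|((s - 1) %% n%:Z)%Z|%N.+1.

Definition alpha (m n : nat) c a (t : nat) : R :=
  circ_entry n a (n - m + 1) (n - m + t)
  - \sum_(1 <= l < m) c l * circ_entry n a (n - m + 1 + l) (n - m + t)
  - c m * circ_entry n a 1 (n - m + t).

Definition is_bseq (m n : nat) c a (r : nat) b : Prop :=
  (forall i, (1 <= i < m)%N -> b i = (i == r)%:R) /\
  (forall s, (m <= s)%N ->
     b s = \sum_(1 <= j < m)
             - (alpha m n c a j.+1 / alpha m n c a 1) * b (s - j)%N).

(* k lists k_1, ..., k_{m-1}, so that k_j is its item number j - 1. *)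
Definition shift_mx (m n : nat) a (k : seq nat) : 'M[R]_m :=
  \matrix_(i < m, j < m)
    if j == 0%N :> nat then a i.+1
    else a (bridx n (nth 0%N k j.-1 + i)%N%:Z).

End Circulant.

(* Main.v *)
(** Transposing the circulant matrix gives [M p q = x (p - q + 1)], indexed from 0, where [x] is
    the [n]-periodic extension of [a]. Let [d] be the residual of the recurrence
    on [x]: it vanishes at [m+1, ..., n] and equals [alpha t] at [t = 1, ..., m].
    Unipotent row operations replace every row [p >= m] of [M] by [d (p - q + 1)],
    and the unipotent column operations given by the sequences [b r], which solve
    the recurrence with coefficients [alpha], clear the lower left block. The
    lower right block is triangular with diagonal [alpha 1 = a 1 - a (n+1)], and
    the multilinear expansion of the upper left block is the sum over the [k]. *)
Require Import Defs.
From HB Require Import structures.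
From mathcomp Require Import all_boot all_order all_algebra.
From mathcomp Require Import perm reals zify ring.

Set Implicit Arguments.
Unset Strict Implicit.
Unset Printing Implicit Defensive.

Import Order.TTheory GRing.Theory Num.Theory.
Local Open Scope ring_scope.

(** * Determinant identities and a windowed sum *)

Lemma det_dlsubmx0 (R : comNzRingType) (m k : nat) (A : 'M[R]_(m + k)) :
  dlsubmx A = 0 -> \det A = \det (ulsubmx A) * \det (drsubmx A).
Proof. by move=> A0; rewrite -[A in LHS]submxK A0 det_ublock. Qed.

Lemma det_unitrig (R : comNzRingType) (n : nat) (A : 'M[R]_n) :
  (forall i j : 'I_n, (i <= j)%N -> A i j = (i == j)%:R) -> \det A = 1.
Proof.
move=> A1; rewrite det_trig; last first.
  by apply/is_trig_mxP=> i j ij; rewrite A1 ?(ltnW ij) // -val_eqE ltn_eqF.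
by rewrite big1 // => i _; rewrite A1 // eqxx.
Qed.

(** Multilinearity in every column but the first. Transposing makes the Leibniz product run over
    columns; distributing it over the inner sums leaves one choice [tnth k i] of a summand per
    column. *)
Lemma det_col_sums (R : comNzRingType) (m : nat) (I : finType) (P : pred I)
    (u : 'I_m.+1 -> R) (x : 'I_m.+1 -> I -> R) (y : 'I_m -> I -> R) :
  \det (\matrix_(i < m.+1, j < m.+1)
          if unlift ord0 j is Some r then \sum_(q | P q) x i q * y r q
          else u i) =
  \sum_(k : m.-tuple I | [forall i, P (tnth k i)])
    \det (\matrix_(i < m.+1, j < m.+1)
          if unlift ord0 j is Some r then x i (tnth k r) else u i) *
    \prod_(i < m) y i (tnth k i).
Proof.
rewrite -det_tr.
under [RHS]eq_bigr => k _ do rewrite -det_tr /determinant mulr_suml.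
rewrite /determinant exchange_big; apply: eq_bigr => /= s _.
under [RHS]eq_bigr => k _ do rewrite -mulrA.
rewrite -mulr_sumr; congr (_ * _).
under [RHS]eq_bigr => k _.
  rewrite big_ord_recl !mxE unlift_none -mulrA -big_split /=.
  under eq_bigr => i _ do rewrite !mxE liftK.
  over.
rewrite -mulr_sumr big_ord_recl !mxE unlift_none; congr (_ * _).
under [LHS]eq_bigr => i _ do rewrite !mxE liftK.
rewrite (bigA_distr_big P (fun (i : 'I_m) q => x (s (lift ord0 i)) q * y i q)).
rewrite (reindex (fun k : m.-tuple I => [ffun i => tnth k i])) /=; last first.
  exists (fun f : {ffun 'I_m -> I} => [tuple f i | i < m]) => [k|f] _.
    by apply: eq_from_tnth => i; rewrite tnth_mktuple ffunE.
  by apply/ffunP=> i; rewrite ffunE tnth_mktuple.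
apply: eq_big => [k|k _]; last by apply: eq_bigr => i _; rewrite ffunE.
by apply: eq_forallb => i; rewrite ffunE.
Qed.

Lemma sum_nat_window (V : zmodType) (F : nat -> V) (p m n : nat) :
  (m <= p <= n)%N ->
  (forall j, (j < n)%N -> ~~ (p - m <= j < p)%N -> F j = 0) ->
  \sum_(0 <= j < n) F j = \sum_(1 <= l < m.+1) F (p - l)%N.
Proof.
move=> /andP[mp pn] F0.
rewrite (big_cat_nat (n := (p - m)%N)) //=; last by lia.
rewrite big_nat_cond big1 ?add0r; last by move=> j hj; apply: F0; lia.
rewrite (big_cat_nat (n := p)) //=; last by lia.
rewrite [X in _ + X]big_nat_cond [X in _ + X]big1 ?addr0; last first.
  by move=> j hj; apply: F0; lia.
rewrite big_nat_rev /= -{1}[(p - m)%N]add0n big_addn subKn // big_add1 /=.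
by apply: eq_big_nat => j hj; congr F; lia.
Qed.

(** * Periodic extension and the residual of the recurrence *)

Lemma bridx_small (n s : nat) : (0 < s <= n)%N -> bridx n s%:Z = s.
Proof. by move=> hs; rewrite /bridx modz_small; lia. Qed.

Lemma bridxDn (n : nat) (s : int) : bridx n (s + n%:Z) = bridx n s.
Proof. by rewrite /bridx addrAC modzDr. Qed.

Section CirculantDeterminant.
Variables (R : realType) (m n : nat) (c a : nat -> R).

(** Integer arguments let index differences be shifted by [n] without truncation. *)
Definition periodize (s : int) : R := a (bridx n s).

Definition residual (s : int) : R :=
  periodize s - \sum_(1 <= l < m.+1) c l * periodize (s - l%:Z).

Lemma periodize_small (s : nat) : (0 < s <= n)%N -> periodize s%:Z = a s.
Proof. by move=> hs; rewrite /periodize bridx_small. Qed.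

Lemma periodizeDn (s : int) : periodize (s + n%:Z) = periodize s.
Proof. by rewrite /periodize bridxDn. Qed.

Lemma residualDn (s : int) : residual (s + n%:Z) = residual s.
Proof.
rewrite /residual periodizeDn; congr (_ - _).
by apply: eq_bigr => l _; rewrite addrAC periodizeDn.
Qed.

Lemma circ_entryE (i j : nat) : (0 < i <= n)%N -> (0 < j <= n)%N ->
  circ_entry n a i j = periodize (j%:Z - i%:Z + 1).
Proof.
move=> hi hj; rewrite /circ_entry; case: leqP => ij.
  by rewrite -periodize_small; [congr periodize|]; lia.
by rewrite -periodizeDn -periodize_small; [congr periodize|]; lia.
Qed.

(** Both [s] and every [s - l] with [1 <= l <= m] lie between 1 and [n], where [periodize] agrees
    with [a], so the recurrence applies. *)
Lemma residual0 (s : nat) :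
  linrec m c a -> (m < s <= n)%N -> residual s%:Z = 0.
Proof.
move=> ha /andP[ms sn]; rewrite /residual periodize_small; last by lia.
rewrite ha // -sumrB big1_seq // => l; rewrite mem_index_iota => /andP[_ hl].
have -> : s%:Z - l%:Z = (s - l)%N%:Z by lia.
by rewrite periodize_small ?subrr //; lia.
Qed.

(** Row [n - m + 1 + l] of the circulant meets column [n - m + t] in [periodize (t - l)]. For
    [l = m] row 1 takes the place of row [n + 1], in agreement with periodicity. *)
Lemma alphaE (t : nat) :
  (m < n)%N -> (1 <= t <= m)%N -> alpha m n c a t = residual t%:Z.
Proof.
move=> hn ht; rewrite /alpha /residual big_nat_recr /=; last by lia.
rewrite opprD addrA.
congr (_ - _ - _).
- by rewrite circ_entryE; [congr periodize|..]; lia.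
- apply: eq_big_nat => l hl; congr (_ * _).
  by rewrite circ_entryE; [congr periodize|..]; lia.
- rewrite circ_entryE; [|lia..].
  by rewrite -[in RHS]periodizeDn; congr (_ * periodize _); lia.
Qed.

Lemma alpha1 : (1 <= m < n)%N -> linrec m c a ->
  alpha m n c a 1 = a 1%N - a n.+1.
Proof.
move=> /andP[hm hn] ha.
rewrite alphaE ?hm // /residual periodize_small; last by lia.
(* The recurrence expands [a n.+1] into terms [a (n + 1 - l)], which are the values
   [periodize (1 - l)]. *)
congr (_ - _); rewrite ha; last by lia.
apply: eq_big_nat => l hl; congr (_ * _).
by rewrite -periodizeDn -periodize_small; [congr periodize|]; lia.
Qed.

(** * Row reduction by the recurrence *)

Definition reduced_mx : 'M[R]_n :=
  \matrix_(p, q) if (p < m)%N then periodize (p%:Z - q%:Z + 1)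
                 else residual (p%:Z - q%:Z + 1).

(** Acting from the left, it subtracts from each row [p >= m] the rows [p - l] times [c l], for
    [1 <= l <= m]. *)
Definition row_reduction : 'M[R]_n :=
  \matrix_(p, q) ((p == q)%:R -
    if (m <= p)%N && (p - m <= q < p)%N then c (p - q)%N else 0).

Lemma row_reductionE : row_reduction *m (circ n a)^T = reduced_mx.
Proof.
apply/matrixP => p q; rewrite !mxE.
under eq_bigr => j _.
  rewrite !mxE circ_entryE ?ltn_ord //
    (_ : j.+1%:Z - q.+1%:Z + 1 = j%:Z - q%:Z + 1) ?mulrBl; last by lia.
  over.
rewrite /= sumrB (bigD1 p) //= eqxx mul1r [X in _ + X - _]big1 ?addr0; last first.
  by move=> j /negbTE; rewrite eq_sym => ->; rewrite mul0r.
case: (ltnP p m) => pm /=.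
  by rewrite big1 ?subr0 // => j _; rewrite mul0r.
rewrite /residual; congr (_ - _).
pose F j := (if (p - m <= j < p)%N then c (p - j)%N else 0) *
  periodize (j%:Z - q%:Z + 1).
transitivity (\sum_(0 <= j < n) F j).
  by rewrite big_mkord; apply: eq_bigr.
rewrite (@sum_nat_window _ F p m) ?(ltnW (ltn_ord p)) ?pm //.
  by apply: eq_big_nat => l hl; rewrite /F ifT; [congr (c _ * periodize _)|]; lia.
by move=> j _ /negbTE hj; rewrite /F hj mul0r.
Qed.

Lemma det_row_reduction : \det row_reduction = 1.
Proof.
apply: det_unitrig => i j ij; rewrite mxE ifF ?subr0 //.
by rewrite [(j < i)%N]ltnNge ij !andbF.
Qed.

(** * Column reduction by the sequences [b r] *)

Variable b : nat -> nat -> R.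

(** The sequences start at index 1 and [b r 0] is unspecified, hence the explicit 0 in row 0. *)
Definition col_reduction : 'M[R]_n :=
  \matrix_(q, r) if (0 < r < m)%N then (if q == 0%N :> nat then 0 else b r q)
                 else (q == r)%:R.

(** On or above the diagonal of a column [j < m] the row index is below [m] too, so only the initial
    values of [b j] occur, and these are Kronecker deltas. *)
Lemma det_col_reduction :
  (forall r, (1 <= r < m)%N -> is_bseq m n c a r (b r)) ->
  \det col_reduction = 1.
Proof.
move=> hb.
apply: det_unitrig => i j ij; rewrite mxE; case: ifP => // hj.
have [b1 _] := hb _ hj; case: eqP => i0.
  by rewrite -val_eqE /= i0 ltn_eqF //; case/andP: hj.
rewrite b1; last by lia.
by rewrite -val_eqE.
Qed.

Let W := reduced_mx *m col_reduction.

Lemma reduced_col_id (p r : 'I_n) : ~~ (0 < r < m)%N -> W p r = reduced_mx p r.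
Proof.
move=> /negbTE hr; rewrite mxE (bigD1 r) //= [X in _ * X]mxE hr eqxx mulr1.
rewrite big1 ?addr0 // => q /negbTE qr.
by rewrite [X in _ * X]mxE hr qr mulr0.
Qed.

(** For [r > 0] the entry is a convolution of [residual] with [b r]. Only the residuals at
    [1, ..., m] survive; they are the [alpha l], and the sum vanishes by the recurrence of [b r] at
    index [p], multiplied by [alpha 1]. *)
Lemma reduced_lower_left0 (p r : 'I_n) :
  linrec m c a -> (m < n)%N -> ((2 <= m)%N -> alpha m n c a 1 != 0) ->
  (forall r, (1 <= r < m)%N -> is_bseq m n c a r (b r)) ->
  (m <= p)%N -> (r < m)%N -> W p r = 0.
Proof.
move=> ha hn alpha1_neq0 hb mp rm; have pn := ltn_ord p.
have [r0|r0] := posnP r.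
  rewrite reduced_col_id ?r0 // mxE ltnNge mp /= r0 subr0 -[1]/(1%:Z) -PoszD.
  by apply: residual0 => //; lia.
have hr : (0 < r < m)%N by rewrite r0.
have m2 : (2 <= m)%N by lia.
pose F q := residual (p%:Z - q%:Z + 1) * (if q == 0%N then 0 else b r q).
transitivity (\sum_(0 <= q < n) F q).
  by rewrite mxE big_mkord; apply: eq_bigr => q _; rewrite !mxE hr ltnNge mp.
rewrite (@sum_nat_window _ F p.+1 m); [|lia|]; last first.
  move=> q qn hq; rewrite /F; case: eqP => [_|q0]; first by rewrite mulr0.
  have [qp|pq] := ltnP q p.+1.
    have -> : p%:Z - q%:Z + 1 = (p - q + 1)%N%:Z by lia.
    by rewrite residual0 ?mul0r //; lia.
  (* Here [p - q + 1 <= 0]; one period later it lies in [m + 1, ..., n]. *)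
  rewrite -residualDn.
  have -> : p%:Z - q%:Z + 1 + n%:Z = (p + n - q + 1)%N%:Z by lia.
  by rewrite residual0 ?mul0r //; lia.
transitivity (\sum_(1 <= l < m.+1) alpha m n c a l * b r (p.+1 - l)).
  (* Since [p >= m], the window starts at [p + 1 - m >= 1] and avoids the default at 0. *)
  apply: eq_big_nat => l hl; rewrite /F ifF; last by lia.
  by rewrite alphaE //; congr (residual _ * _); lia.
rewrite big_ltn; last by lia.
rewrite subn1 /= (proj2 (hb _ hr)) // big_add1 /= mulr_sumr -big_split /=.
rewrite big1_seq // => j _; rewrite subSS.
by field; exact: alpha1_neq0.
Qed.

(** The substitution [k = n - q + 1] maps [q = 1, ..., n - 1] onto [k = n, ..., 2], and adding a
    period turns [p - q + 1] into [k + p]. *)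
Lemma reduced_upper_left (p r : 'I_n) : (p < m)%N -> (0 < r < m)%N ->
  W p r = \sum_(k : 'I_n.+1 | (2 <= k)%N)
            a (bridx n (k + p)%N%:Z) * b r (n - k + 1)%N.
Proof.
move=> pm hr; have rn := ltn_ord r.
pose F q := periodize (p%:Z - q%:Z + 1) * (if q == 0%N then 0 else b r q).
transitivity (\sum_(0 <= q < n) F q).
  by rewrite mxE big_mkord; apply: eq_bigr => q _; rewrite !mxE hr pm.
pose G k := periodize (k + p)%N%:Z * b r (n - k + 1)%N.
transitivity (\sum_(2 <= k < n.+1) G k); last first.
  transitivity (\sum_(0 <= k < n.+1) if (2 <= k)%N then G k else 0); last first.
    by rewrite big_mkord -big_mkcond.
  rewrite [RHS]big_ltn // [in RHS]big_ltn /= ?add0r; last by lia.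
  by apply: eq_big_nat => k /andP[-> _].
rewrite big_ltn; last by lia.
rewrite {1}/F eqxx mulr0 add0r big_nat_rev /= [RHS]big_add1 /=.
apply: eq_big_nat => q hq; rewrite /F /G ifF; last by lia.
by rewrite -periodizeDn; congr (periodize _ * b r _); lia.
Qed.

Lemma det_circ_reduced :
  (forall r, (1 <= r < m)%N -> is_bseq m n c a r (b r)) ->
  \det (circ n a) = \det W.
Proof.
move=> hb.
by rewrite -det_tr /W -row_reductionE !det_mulmx det_row_reduction
  det_col_reduction // mul1r mulr1.
Qed.

End CirculantDeterminant.

(** * Evaluation of the two diagonal blocks *)

Theorem lemma2p1 (R : realType) (m n : nat) (c a : nat -> R)
    (b : nat -> nat -> R)
    (hm : (1 <= m)%N) (hcm : c m != 0) (ha : linrec m c a)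
    (hn : (m < n)%N) (ha1 : (2 <= m)%N -> a 1%N != a n.+1)
    (hb : forall r, (1 <= r < m)%N -> is_bseq m n c a r (b r)) :
  \det (circ n a) =
    (a 1%N - a n.+1) ^+ (n - m) *
    \sum_(k : m.-1.-tuple 'I_n.+1 | [forall i, (2 <= tnth k i)%N])
      \det (shift_mx m n a [seq nat_of_ord x | x <- k]) *
      \prod_(i < m.-1) b i.+1 (n - tnth k i + 1)%N.
Proof.
have a1 : alpha m n c a 1 = a 1%N - a n.+1 by apply: alpha1; rewrite ?hm.
have a1n0 : (2 <= m)%N -> alpha m n c a 1 != 0 by rewrite a1 subr_eq0.
rewrite (det_circ_reduced hb).
have [k nE] : exists k, n = (m + k)%N by exists (n - m)%N; lia.
case: m hm => // m _ in c a b hcm ha hn ha1 hb a1 a1n0 nE *.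
subst n; rewrite det_dlsubmx0; last first.
  apply/matrixP => p r; rewrite mxE [in LHS]mxE [RHS]mxE.
  by apply: reduced_lower_left0; rewrite //= ?leq_addr.
rewrite mulrC; congr (_ * _).
  (* Above the diagonal of the lower right block the residual index, shifted by [n], falls where the
     residual vanishes; on the diagonal it is 1. *)
  rewrite det_trig; last first.
    apply/is_trig_mxP => p r pr; rewrite mxE [in LHS]mxE.
    rewrite reduced_col_id /=; last by lia.
    rewrite mxE ifF /=; last by lia.
    rewrite -residualDn.
    have -> : (m.+1 + p)%N%:Z - (m.+1 + r)%N%:Z + 1 + (m.+1 + k)%N%:Z =
              (p + (m.+1 + k) - r + 1)%N%:Z by have := ltn_ord r; lia.
    by apply: residual0 => //; have := ltn_ord r; lia.
  rewrite -a1 addKn -[X in _ ^+ X]card_ord -prodr_const; apply: eq_bigr => p _.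
  rewrite mxE [in LHS]mxE reduced_col_id /=; last by lia.
  rewrite mxE ifF /=; last by lia.
  by rewrite subrr add0r (alphaE c a hn).
pose x (i : 'I_m.+1) (q : 'I_(m.+1 + k).+1) :=
  a (bridx (m.+1 + k) (q + i)%N%:Z).
pose y (i : 'I_m) (q : 'I_(m.+1 + k).+1) := b i.+1 (m.+1 + k - q + 1)%N.
pose P (q : 'I_(m.+1 + k).+1) := (2 <= q)%N.
(* [unlift ord0] separates the untouched column 0, which holds the initial values of [a], from the
   columns [r.+1], which are sums over [k]. *)
transitivity (\det (\matrix_(i < m.+1, j < m.+1)
    if unlift ord0 j is Some r then \sum_(q | P q) x i q * y r q
    else a i.+1)).
  congr determinant; apply/matrixP => i j; rewrite [LHS]mxE [LHS]mxE [RHS]mxE.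
  case: unliftP => [r|] ->.
    by rewrite reduced_upper_left /= ?ltn_ord ?lift0 ?ltnS ?ltn_ord.
  rewrite reduced_col_id // mxE /= ltn_ord subr0 -[1]/(1%:Z) -PoszD addn1.
  by rewrite periodize_small //=; have := ltn_ord i; lia.
rewrite (det_col_sums P); apply: eq_bigr => q _; congr (\det _ * _).
apply/matrixP => i j; rewrite !mxE; case: unliftP => [r|] -> //=.
by rewrite (nth_map ord0) ?size_tuple ?(tnth_nth ord0) ?ltn_ord //=; apply: ltn_ord.
Qed.
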